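(* Let $s\geq1$ be an integer and let $X$ and $Y$ be random variables with absolutely continuous distributions with densities $f_X$ and $f_Y$ and distribution functions $F_X,F_Y\in\mathcal{F}$. If, for some positive integer $k\leq s$ and every $a>0$ and $b\in\mathbb{R}$, the function $$ H_k(x)=\frac{1}{\prod_{j=1}^{k}\widetilde{\mu}_{Y,s-j}}\overline{T}_{Y,s-k}(x)-\frac{a^{k}}{\prod_{j=1}^{k}\widetilde{\mu}_{X,s-j}}\overline{T}_{X,s-k}(ax+b) $$ changes sign at most twice as $x$ traverses from $0$ to $+\infty$, and if the change of sign occurs twice it is in the order ''$+,-,+$'', then $F_X\leq_{s\text{-IFR}}F_Y$.
   Context: $\mathcal{F}$ denotes the family of distribution functions $F$ with $F(0)=0$ whose probability distribution has support contained in $[0,\infty)$. For a nonnegative random variable $X$ with density $f_X$: $\overline{T}_{X,0}=f_X$, $\widetilde{\mu}_{X,0}=1$, and for $s\geq1$, $x\geq0$, $\overline{T}_{X,s}(x)=\frac{1}{\widetilde{\mu}_{X,s-1}}\int_x^\infty \overline{T}_{X,s-1}(t)\,dt$ with $\widetilde{\mu}_{X,s}=\int_0^\infty \overline{T}_{X,s}(t)\,dt$, and $\overline{T}_{X,s}(x)=1$ for $x<0$ (for $s\geq1$). We write $F_X\leq_{s\text{-IFR}}F_Y$ (''$X$ is more $s$-IFR than $Y$'') if $c_s(x)=\overline{T}_{Y,s}^{-1}(\overline{T}_{X,s}(x))$ is convex. *)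

(* Defs.v *)
From HB Require Import structures.
From mathcomp Require Import all_boot all_order all_algebra.
From mathcomp Require Import all_classical all_reals all_analysis.
Set Implicit Arguments. Unset Strict Implicit. Unset Printing Implicit Defensive.
Import Order.TTheory GRing.Theory Num.Theory.
Import numFieldNormedType.Exports.
Local Open Scope classical_set_scope.
Local Open Scope ring_scope.

Section Defs.
Variable R : realType.
Local Notation mu := (@lebesgue_measure R).

(* f is the density of a nonnegative absolutely continuous random variable,
   i.e. its distribution function F(x) = \int_{(-oo,x]} f lies in the family
   \mathcal{F} (support in [0,oo), F(0) = 0). *)
Definition nonneg_density (f : R -> R) : Prop :=
  [/\ measurable_fun setT f,
      (forall x, 0 <= f x),
      (forall x, x < 0 -> f x = 0) &
      (\int[mu]_(t in setT) (f t)%:E = 1)%E].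

Definition distr_fun (f : R -> R) (x : R) : R :=
  fine (\int[mu]_(t in [set t | t <= x]) (f t)%:E).

Fixpoint TMu (f : R -> R) (s : nat) : (R -> R) * R :=
  match s with
  | 0 => (f, 1)
  | s'.+1 =>
      let T := (TMu f s').1 in
      let m := (TMu f s').2 in
      let T' := fun x => if x < 0 then 1
                         else m^-1 * fine (\int[mu]_(t in [set t | x <= t]) (T t)%:E) in
      (T', fine (\int[mu]_(t in [set t | 0 <= t]) (T' t)%:E))
  end.

Definition Tbar (f : R -> R) (s : nat) : R -> R := (TMu f s).1.
Definition mutilde (f : R -> R) (s : nat) : R := (TMu f s).2.

(* \overline{T}_{X,j} is integrable over [0,oo) for every j < s, so that all
   \widetilde{\mu}_{X,j}, j < s, (and hence \overline{T}_{X,s}) are well defined. *)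
Definition finite_mutilde_upto (f : R -> R) (s : nat) : Prop :=
  forall j, (j < s)%N ->
    (\int[mu]_(t in [set t | (0 <= t)%R]) (Tbar f j t)%:E < +oo)%E.

Definition geninv (T : R -> R) (u : R) : R := inf [set y | 0 <= y /\ T y <= u].

Definition convex_on (D : set R) (c : R -> R) : Prop :=
  forall x y t, D x -> D y -> 0 <= t <= 1 ->
    c (t * x + (1 - t) * y) <= t * c x + (1 - t) * c y.

Definition c_s (fX fY : R -> R) (s : nat) (x : R) : R :=
  geninv (Tbar fY s) (Tbar fX s x).

(* F_X <=_{s-IFR} F_Y : c_s is convex on the support [0, r_X) of
   \overline{T}_{X,s}, i.e. on { x >= 0 | \overline{T}_{X,s}(x) > 0 }. *)
Definition s_IFR_le (fX fY : R -> R) (s : nat) : Prop :=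
  convex_on [set x | 0 <= x /\ 0 < Tbar fX s x] (c_s fX fY s).

Definition nsignchanges (v : seq R) : nat :=
  let w := [seq z <- v | z != 0] in
  count (fun p : R * R => p.1 * p.2 < 0) (zip w (behead w)).

Definition first_nonzero (v : seq R) : R := head 0 [seq z <- v | z != 0].

(* H changes sign at most twice on [0,+oo) (S^-(H) <= 2), and whenever it
   changes sign twice the order is "+, -, +". *)
Definition at_most_two_sign_changes_pmp (H : R -> R) : Prop :=
  forall xs : seq R, sorted <%R xs -> all (fun x => 0 <= x) xs ->
    (nsignchanges (map H xs) <= 2)%N /\
    (nsignchanges (map H xs) = 2%N -> 0 < first_nonzero (map H xs)).

Definition H_k (fX fY : R -> R) (s k : nat) (a b x : R) : R :=
  (\prod_(1 <= j < k.+1) mutilde fY (s - j))^-1 * Tbar fY (s - k) x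
  - a ^+ k / (\prod_(1 <= j < k.+1) mutilde fX (s - j)) * Tbar fX (s - k) (a * x + b).

End Defs.

(* Main.v *)
(** Suppose [c_s] fails to be convex at [x < z < y].  Lifting the chord slightly
    gives a line [w = (v - b) / a] of positive slope lying above [c_s] at [x] and
    [y] and below it at [z], so that [H_0(w) := T_{Y,s}(w) - T_{X,s}(a w + b)] is
    [<= 0], [> 0], [<= 0] at three points with [a w + b >= 0].  On that range
    [H_j] is the tail integral of [H_{j+1}]; this forces the strict pattern
    "-, +, -" on [H_1], hence on [H_2], ..., [H_k], which is excluded.  The only
    obstruction is that [H_0] may vanish identically beyond the last point (the
    densities may have gaps, so [T_{Y,1}] need not be strictly decreasing).  If
    this happens for two parallel lines, then [T_{X,s}] is periodic on [[y, oo)],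
    hence zero there since it is monotone with limit [0], contradicting
    [T_{X,s}(y) > 0]. *)

Require Import Defs.
From HB Require Import structures.
From mathcomp Require Import all_boot all_order all_algebra.
From mathcomp Require Import all_classical all_reals all_analysis.
From mathcomp Require Import measurable_realfun.
From mathcomp Require Import ring lra.
Import Order.TTheory GRing.Theory Num.Theory.
Import numFieldNormedType.Exports.
Local Open Scope classical_set_scope.
Local Open Scope ring_scope.

(** * Tail integrals over half-lines *)

Section TailIntegral.
Set Implicit Arguments. Unset Strict Implicit. Unset Printing Implicit Defensive.
Context {R : realType}.
Implicit Types (g u v : R -> R) (a b p x y : R).
Local Notation mu := (@lebesgue_measure R).

Definition etail g x : \bar R := (\int[mu]_(t in [set t | (x <= t)%R]) (g t)%:E)%E.
Definition tail g x : R := fine (etail g x).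

(** Integrability is asked only from [p] on: [Tbar f j.+1] is 1 on the negative axis, so its
    integral over the whole line diverges. *)
Definition tail_integrable p g : Prop :=
  [/\ measurable_fun setT g, forall x, 0 <= g x & (etail g p < +oo)%E].

Lemma ray_itv x : [set t | x <= t] = `[x, +oo[%classic.
Proof. by apply/seteqP; split => t /=; rewrite in_itv/= andbT. Qed.

Lemma measurable_ray x : measurable ([set t | x <= t] : set (measurableTypeR R)).
Proof. by rewrite ray_itv; exact: measurable_itv. Qed.

Hint Resolve measurable_ray : core.

Lemma measurable_EFinS {D : set R} {g} :
  measurable_fun setT g -> measurable_fun D (EFin \o g).
Proof.
by move=> mg; apply/measurable_EFinP; apply: measurable_funS mg.
Qed.

Lemma etail_ge0 g x : (forall t, 0 <= g t) -> (0 <= etail g x)%E.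
Proof. by move=> g0; apply: integral_ge0 => t _; rewrite lee_fin. Qed.

Lemma tail_ge0 g x : (forall t, 0 <= g t) -> 0 <= tail g x.
Proof. by move=> g0; apply: fine_ge0; exact: etail_ge0. Qed.

Lemma etail_le g x y : measurable_fun setT g -> (forall t, 0 <= g t) ->
  x <= y -> (etail g y <= etail g x)%E.
Proof.
move=> mg g0 xy; apply: ge0_subset_integral => //.
- exact: measurable_EFinS.
- by move=> t _; rewrite lee_fin.
- by move=> t /=; exact: le_trans.
Qed.

Lemma etailE {p g x} : tail_integrable p g -> p <= x ->
  etail g x = (tail g x)%:E.
Proof.
move=> [mg g0 goo] px; rewrite /tail fineK// ge0_fin_numE ?etail_ge0//.
by apply: le_lt_trans goo; exact: etail_le.
Qed.

Lemma le_tail {p g x y} : tail_integrable p g -> p <= x -> x <= y ->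
  tail g y <= tail g x.
Proof.
move=> gi px xy; rewrite -lee_fin -!(etailE gi)// ?(le_trans px)//.
by case: gi => mg g0 _; exact: etail_le.
Qed.

Lemma etail_split g x y : measurable_fun setT g -> (forall t, 0 <= g t) ->
  x <= y ->
  (etail g x = \int[mu]_(t in `[x, y[) (g t)%:E + etail g y)%E.
Proof.
move=> mg g0 xy; rewrite /etail !ray_itv -ge0_integral_setU//=.
- congr integral; apply/seteqP; split => t /=; rewrite !in_itv/= !andbT.
    by move=> xt; case: (ltP t y) => ty; [left; rewrite xt|right].
  by case=> [/andP[]//|]; exact: le_trans.
- exact: measurable_EFinS.
- by move=> t _; rewrite lee_fin.
- by rewrite disj_set2E; apply/eqP/seteqP; split => t //= [];
    rewrite !in_itv/= andbT => /andP[_ ty]; rewrite leNgt ty.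
Qed.

Lemma tail_split {p g x y} : tail_integrable p g -> p <= x -> x <= y ->
  (\int[mu]_(t in `[x, y[) (g t)%:E = (tail g x - tail g y)%:E)%E.
Proof.
move=> gi px xy; have py := le_trans px xy.
have [mg g0 _] := gi; have := etail_split mg g0 xy.
rewrite !(etailE gi)// EFinB => ->.
by rewrite addeK.
Qed.

(** If [v <= u] on all of [[x, y]], integrating over [[x, y[] shows that [tail u - tail v] cannot
    increase from [x] to [y]. *)
Lemma tail_diff_lt {p u v x y} : tail_integrable p u -> tail_integrable p v ->
  p <= x -> x <= y -> tail u x - tail v x < tail u y - tail v y ->
  exists z, [/\ x <= z, z <= y & u z < v z].
Proof.
move=> ui vi px xy; apply: contraPP => /forallNP uv.
apply/negP; rewrite -leNgt.
suff : tail v x - tail v y <= tail u x - tail u y by lra.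
rewrite -lee_fin -(tail_split ui px xy) -(tail_split vi px xy).
case: ui vi => mU u0 _ [mv v0 _].
apply: ge0_le_integral => //; [|exact: measurable_EFinS..|].
  by move=> t _; rewrite lee_fin.
move=> t /=; rewrite in_itv/= => /andP[xt ty]; rewrite lee_fin leNgt.
by apply/negP => uvt; apply: (uv t); split => //; exact: ltW.
Qed.

Lemma tail_lt {p u v x} : tail_integrable p u -> tail_integrable p v ->
  p <= x -> tail u x < tail v x -> exists z, x <= z /\ u z < v z.
Proof.
move=> ui vi px; apply: contraPP => /forallNP uv; apply/negP; rewrite -leNgt.
rewrite -lee_fin -(etailE ui px) -(etailE vi px).
case: ui vi => mU u0 _ [mv v0 _].
apply: ge0_le_integral => //; [|exact: measurable_EFinS..|].
  by move=> t _; rewrite lee_fin.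
move=> t /= xt; rewrite lee_fin leNgt.
by apply/negP => uvt; apply: (uv t).
Qed.

(** By monotone convergence the integrals over [[p, p + n[] tend to [tail g p]; tails bounded below
    by [e] would keep them under [tail g p - e]. *)
Lemma tail_small {p g} e : tail_integrable p g -> 0 < e ->
  exists x, p <= x /\ tail g x < e.
Proof.
move=> gi e0; apply: contrapT => /forallNP large.
have [mg g0 _] := gi.
have le_pn n : p <= p + n%:R by rewrite lerDl.
pose F (n : nat) : set (measurableTypeR R) := `[p, p + n%:R[%classic.
have cF : (\int[mu]_(t in F i) (g t)%:E @[i --> \oo] -->
           \int[mu]_(t in \bigcup_i F i) (g t)%:E)%E.
  apply: ge0_nondecreasing_set_cvg_integral => //.
  - move=> m n mn; apply/subsetPset => t; rewrite /F/= !in_itv/= => /andP[-> /=].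
    by move=> /lt_le_trans; apply; rewrite lerD2l ler_nat.
  - by move=> n; exact: measurable_itv.
  - by move=> n; exact: measurable_EFinS.
  - by move=> n t _; rewrite lee_fin.
have UF : \bigcup_i F i = [set t | p <= t].
  apply/seteqP; split => t /=.
    by move=> [n _]; rewrite /F/= in_itv/= => /andP[].
  move=> pt; exists (Num.bound (t - p)) => //; rewrite /F/= in_itv/= pt/=.
  by rewrite addrC -ltrBlDr; apply: archi_boundP; rewrite subr_ge0.
have : (limn (fun i => \int[mu]_(t in F i) (g t)%:E) <= (tail g p - e)%:E)%E.
  apply: lime_le; first by apply/cvg_ex; eexists; exact: cF.
  apply: nearW => n; rewrite (tail_split gi)// lee_fin lerB// leNgt.
  by apply/negP => tn; apply: (large (p + n%:R)).
rewrite (cvg_lim _ cF)// UF -/(etail g p) (etailE gi)// lee_fin.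
lra.
Qed.

(** The rays from [p + 1/(n+1)] exhaust []p, +oo[], and the missing endpoint has measure zero. If
    all these tails vanished, so would the one at [p]. *)
Lemma tail_gt0_right {p g} : tail_integrable p g -> 0 < tail g p ->
  exists x, p < x /\ 0 < tail g x.
Proof.
move=> gi gp; apply: contrapT => /forallNP null.
have [mg g0 _] := gi.
have lt_pn (n : nat) : p < p + n.+1%:R^-1 by rewrite ltrDl invr_gt0.
pose F (n : nat) : set (measurableTypeR R) := [set t | p + n.+1%:R^-1 <= t].
have cF : (\int[mu]_(t in F i) (g t)%:E @[i --> \oo] -->
           \int[mu]_(t in \bigcup_i F i) (g t)%:E)%E.
  apply: ge0_nondecreasing_set_cvg_integral => //.
  - move=> m n mn; apply/subsetPset => t; rewrite /F/=; apply: le_trans.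
    by rewrite lerD2l lef_pV2 ?posrE// ler_nat.
  - by move=> n; exact: measurable_ray.
  - by move=> n; exact: measurable_EFinS.
  - by move=> n t _; rewrite lee_fin.
have UF : \bigcup_i F i = `]p, +oo[%classic.
  apply/seteqP; split => t /=; rewrite in_itv/= andbT.
    by move=> [n _]; exact: lt_le_trans.
  rewrite -subr_gt0 => pt; exists (Num.bound (t - p)^-1) => //; rewrite /F/=.
  rewrite addrC -lerBrDr invf_ple ?posrE//.
  apply: ltW; apply: (@lt_le_trans _ _ (Num.bound (t - p)^-1)%:R).
    by apply: archi_boundP; rewrite invr_ge0 ltW.
  by rewrite ler_nat.
have : (limn (fun i => \int[mu]_(t in F i) (g t)%:E) <= 0%:E)%E.
  apply: lime_le; first by apply/cvg_ex; eexists; exact: cF.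
  apply: nearW => n; change (etail g (p + n.+1%:R^-1) <= 0%:E)%E.
  rewrite (etailE gi (ltW (lt_pn n))) lee_fin leNgt.
  by apply/negP => tn; apply: (null (p + n.+1%:R^-1)).
rewrite (cvg_lim _ cF)// UF integral_itv_obnd_cbnd; last exact: measurable_EFinS.
by rewrite -ray_itv -/(etail g p) (etailE gi)// lee_fin leNgt gp.
Qed.

Lemma etailZ c g x : 0 <= c -> measurable_fun setT g -> (forall t, 0 <= g t) ->
  etail (fun t => c * g t) x = (c%:E * etail g x)%E.
Proof.
move=> c0 mg g0; rewrite /etail; under eq_integral do rewrite EFinM.
rewrite ge0_integralZl_EFin//.
  by move=> t _; rewrite lee_fin.
exact: measurable_EFinS.
Qed.

Lemma measurable_affine a b :
  measurable_fun setT (fun t : R => a * t + b).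
Proof.
apply: measurable_funD; last exact: measurable_cst.
by apply: measurable_funM; [exact: measurable_cst|exact: measurable_id].
Qed.

(** Uniqueness of Lebesgue measure: [a] times the pushforward of [mu] under the affine map gives
    []x, y]] its length. *)
Lemma lebesgue_measure_affine a b (A : set (measurableTypeR R)) :
  0 < a -> measurable A ->
  (mu A = a%:E * mu ((fun t : R => (a * t + b)%R) @^-1` A))%E.
Proof.
move=> a0 mA.
pose phi : measurableTypeR R -> measurableTypeR R := fun t => (a * t + b)%R.
have mphi : measurable_fun setT phi by exact: measurable_affine.
unshelve epose (P := (pushforward mu phi : {measure set _ -> \bar R})).
  exact: mphi.
pose m := mscale (NngNum (ltW a0)) P.
transitivity (m A); last by [].
apply: (@lebesgue_measure_unique R m) => //= _ [[x y]] _ <-.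
change (mu `]x, y]%classic = a%:E * mu (phi @^-1` `]x, y]%classic))%E.
have -> : phi @^-1` `]x, y]%classic = `](x - b) / a, (y - b) / a]%classic.
  apply/seteqP; split => t /=; rewrite !in_itv/= /phi.
    by rewrite ltr_pdivrMr// ler_pdivlMr// => /andP[]; nra.
  by rewrite ltr_pdivrMr// ler_pdivlMr// => /andP[]; nra.
rewrite !lebesgue_measure_itv/= !lte_fin ltr_pM2r ?invr_gt0// ltrD2r.
case: ifP => _; last by rewrite mule0.
rewrite -!EFinB -EFinM; congr EFin; field; lra.
Qed.

Lemma etail_affine a b g x : 0 < a -> measurable_fun setT g ->
  (forall t, 0 <= g t) ->
  etail (fun t => a * g (a * t + b)) x = etail g (a * x + b).
Proof.
move=> a0 mg g0.
pose phi : measurableTypeR R -> measurableTypeR R := fun t => (a * t + b)%R.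
have mphi : measurable_fun setT phi by exact: measurable_affine.
rewrite etailZ ?ltW//; last exact: (measurableT_comp mg mphi).
unshelve epose (P := (pushforward mu phi : {measure set _ -> \bar R})).
  exact: mphi.
pose m := mscale (NngNum (ltW a0)) P.
transitivity (\int[m]_(t in [set t | (a * x + b <= t)%R]) (g t)%:E)%E; last first.
  apply: eq_measure_integral => A mA _; apply/esym.
  exact: (lebesgue_measure_affine b).
rewrite ge0_integral_mscale//; [|exact: measurable_EFinS|by move=> t _; rewrite lee_fin].
congr (_ * _)%E; rewrite ge0_integral_pushforward//.
- congr integral; apply/seteqP; split => t /=; rewrite /phi lerD2r ler_pM2l//.
- exact: measurable_EFinS.
- by move=> t _; rewrite lee_fin.
Qed.

End TailIntegral.

(** * Sign patterns and their passage from tails to integrands *)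

Section SignPattern.
Set Implicit Arguments. Unset Strict Implicit. Unset Printing Implicit Defensive.
Context {R : realType}.
Implicit Types (u v : R -> R) (p : R).

(** The pattern minus, plus, minus for [u - v]. Weakly ordered points suffice, since opposite strict
    signs keep neighbours apart. *)
Definition crosses_mpm p u v : Prop :=
  exists z1 z2 z3, [/\ p <= z1 <= z2, z2 <= z3, u z1 < v z1, v z2 < u z2 &
                       u z3 < v z3].

(** Let [D = tail u - tail v]. Its rise from [y1] to [y2] and its fall from [y2] to [y3] give the
    first two signs. The point [y4] gives the third: if [D] is positive there, it has risen since
    [y3]; if negative, it must still climb to its limit 0. *)
Lemma crosses_mpm_tail_weak p u v y1 y2 y3 y4 :
  tail_integrable p u -> tail_integrable p v ->
  p <= y1 -> y1 <= y2 -> y2 <= y3 -> y3 <= y4 ->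
  tail u y1 <= tail v y1 -> tail v y2 < tail u y2 -> tail u y3 <= tail v y3 ->
  tail u y4 != tail v y4 -> crosses_mpm p u v.
Proof.
move=> ui vi p1 y12 y23 y34 h1 h2 h3 h4.
have p2 := le_trans p1 y12; have p3 := le_trans p2 y23.
have p4 := le_trans p3 y34.
have [|z1 [yz1 zy1 uv1]] := tail_diff_lt ui vi p1 y12; first lra.
have [|z2 [yz2 zy2 uv2]] := tail_diff_lt vi ui p2 y23; first lra.
have [z3 [yz3 uv3]] : exists z, y3 <= z /\ u z < v z.
  move: h4; rewrite neq_lt => /orP[h4|h4].
    have [z [yz uvz]] := tail_lt ui vi p4 h4.
    by exists z; split => //; exact: le_trans yz.
  have [|z [yz _ uvz]] := tail_diff_lt ui vi p3 y34; first lra.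
  by exists z.
exists z1, z2, z3; split => //; last exact: le_trans yz3.
by rewrite (le_trans p1 yz1) (le_trans zy1 yz2).
Qed.

Lemma crosses_mpm_tail p u v : tail_integrable p u -> tail_integrable p v ->
  crosses_mpm p (tail u) (tail v) -> crosses_mpm p u v.
Proof.
move=> ui vi [z1 [z2 [z3 [/andP[p1 z12] z23 h1 h2 h3]]]].
(* The third sign is strict here, so [z3] also serves as the fourth point. *)
apply: (crosses_mpm_tail_weak ui vi p1 z12 z23 (lexx z3)) => //; try exact: ltW.
by rewrite lt_eqF.
Qed.

Lemma eq_crosses_mpm p u v u' v' : (forall x, p <= x -> u x = u' x) ->
  (forall x, p <= x -> v x = v' x) -> crosses_mpm p u v -> crosses_mpm p u' v'.
Proof.
move=> uu' vv' [z1 [z2 [z3 [/andP[p1 z12] z23 h1 h2 h3]]]].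
have p2 := le_trans p1 z12; have p3 := le_trans p2 z23.
by exists z1, z2, z3; split; rewrite -?uu' -?vv'// p1.
Qed.

Lemma crosses_mpm_sign_changes p u v : 0 <= p -> crosses_mpm p u v ->
  ~ at_most_two_sign_changes_pmp (fun x => u x - v x).
Proof.
move=> p0 [z1 [z2 [z3 [/andP[p1 z12] z23 h1 h2 h3]]]].
have {}z12 : z1 < z2.
  by rewrite lt_neqAle z12 andbT; apply/eqP => E; move: h1 h2; rewrite E; lra.
have {}z23 : z2 < z3.
  by rewrite lt_neqAle z23 andbT; apply/eqP => E; move: h2 h3; rewrite E; lra.
have z1_ge0 := le_trans p0 p1.
have d1 : u z1 - v z1 < 0 by lra.
have d2 : 0 < u z2 - v z2 by lra.
have d3 : u z3 - v z3 < 0 by lra.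
move=> /(_ [:: z1; z2; z3]) [].
- by rewrite /= z12 z23.
- by rewrite /= z1_ge0 (le_trans z1_ge0 (ltW z12)) (ltW (le_lt_trans z1_ge0 (lt_trans z12 z23))).
rewrite /nsignchanges /first_nonzero /= (lt_eqF d1) (gt_eqF d2) (lt_eqF d3)/=.
rewrite (nmulr_rlt0 _ d1) d2 (pmulr_rlt0 _ d2) d3/= => _ /(_ erefl).
by rewrite ltNge (ltW d1).
Qed.

End SignPattern.

(** * The iterated tails [Tbar] and their affine rescalings *)

Section IteratedTail.
Set Implicit Arguments. Unset Strict Implicit. Unset Printing Implicit Defensive.
Context {R : realType}.
Implicit Types (f g : R -> R) (a b p x y : R).
Local Notation mu := (@lebesgue_measure R).

Lemma TbarS f j x : 0 <= x ->
  Tbar f j.+1 x = (mutilde f j)^-1 * tail (Tbar f j) x.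
Proof. by move=> x0; rewrite {1}/Tbar /= ltNge x0. Qed.

Lemma TbarS_lt0 f j x : x < 0 -> Tbar f j.+1 x = 1.
Proof. by move=> x0; rewrite /Tbar /= x0. Qed.

Lemma density_tail f : nonneg_density f ->
  tail_integrable 0 f /\ tail f 0 = 1.
Proof.
move=> [mf f0 fneg f1].
suff E : etail f 0 = 1%E by split; [split => //|]; rewrite ?/tail E ?ltry.
rewrite -f1 /etail integral_mkcond; apply: eq_integral => x _.
rewrite patchE; case: ifPn => //; rewrite notin_setE /= => /negP.
by rewrite -ltNge => /fneg ->.
Qed.

(** A rectangle of width [x] and height [g x] fits under [g]. *)
Lemma tail_gt0 g x : tail_integrable 0 g ->
  (forall y z, y <= z -> g z <= g y) -> 0 < x -> 0 < g x -> 0 < tail g 0.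
Proof.
move=> gi gdec x0 gx; have [mg g0 _] := gi.
suff : x * g x <= tail g 0 - tail g x.
  have := tail_ge0 x g0; have := mulr_gt0 x0 gx; lra.
rewrite -lee_fin -(tail_split gi (lexx 0) (ltW x0)).
have -> : (x * g x)%:E = (\int[mu]_(t in `[0%R, x[) (g x)%:E)%E.
  rewrite integral_cst//= lebesgue_measure_itv/= lte_fin x0 sube0 -EFinM.
  by rewrite mulrC.
apply: ge0_le_integral => //.
- by move=> t _; rewrite lee_fin.
- exact: measurable_EFinS.
- move=> t /=; rewrite in_itv/= => /andP[_ tx].
  by rewrite lee_fin gdec// ltW.
Qed.

(** The last clause makes [Tbar f j.+1] equal 1 at 0, so that it continues its constant value on the
    negative axis monotonically. *)
Definition regular_Tbar f j : Prop :=
  [/\ tail_integrable 0 (Tbar f j), 0 < mutilde f j &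
      tail (Tbar f j) 0 = mutilde f j].

Lemma TbarS_ge0 f j x : regular_Tbar f j -> 0 <= Tbar f j.+1 x.
Proof.
move=> [[_ T0 _] m0 _]; have [x0|x0] := ltP x 0; first by rewrite TbarS_lt0.
by rewrite TbarS// mulr_ge0 ?invr_ge0 ?tail_ge0// ltW.
Qed.

Lemma le_TbarS f j x y : regular_Tbar f j -> x <= y ->
  Tbar f j.+1 y <= Tbar f j.+1 x.
Proof.
move=> [Ti m0 mE] xy; have [x0|x0] := ltP x 0; last first.
  have y0 := le_trans x0 xy.
  by rewrite !TbarS// ler_pM2l ?invr_gt0//; exact: le_tail Ti _ _.
rewrite (TbarS_lt0 f j x0); have [y0|y0] := ltP y 0; first by rewrite TbarS_lt0.
by rewrite TbarS// mulrC ler_pdivrMr// mul1r -mE; exact: le_tail Ti _ _.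
Qed.

(** Induction on [j]; the point is positivity. A positive tail at 0 stays positive slightly to the
    right, so the nonincreasing [Tbar f j.+1] is positive at some [x > 0] and has positive
    integral. *)
Lemma regular_TbarP f s j : nonneg_density f -> finite_mutilde_upto f s ->
  (j < s)%N -> regular_Tbar f j.
Proof.
move=> df fin; elim: j => [|j IH] js.
  by have [fi f1] := density_tail df; split.
have reg := IH (ltnW js).
have Tdec y z : y <= z -> Tbar f j.+1 z <= Tbar f j.+1 y by exact: le_TbarS.
have Ti : tail_integrable 0 (Tbar f j.+1).
  split; [|by move=> x; exact: TbarS_ge0|exact: fin].
  exact: nonincreasing_measurable.
split => //; rewrite -[mutilde _ _]/(tail (Tbar f j.+1) 0).
have [Tj m0 mE] := reg.
have [|x [x0 Tx]] := tail_gt0_right Tj; first by rewrite mE.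
apply: (tail_gt0 Ti Tdec x0).
by rewrite TbarS ?ltW// mulr_gt0// invr_gt0.
Qed.

Lemma TbarS_small f j e : regular_Tbar f j -> 0 < e ->
  exists x, 0 <= x /\ Tbar f j.+1 x < e.
Proof.
move=> [Ti m0 _] e0; have [x [x0 xe]] := tail_small Ti (mulr_gt0 m0 e0).
exists x; split => //.
by rewrite TbarS// -(ltr_pM2l m0) mulrA mulfV ?mul1r// gt_eqF.
Qed.

(** Common form of both terms of [H_k]; the term of [Y] has [a = 1] and [b = 0]. A larger [j] means
    fewer integrations. *)
Definition scaled_Tbar f s j a b x : R :=
  a ^+ j / (\prod_(1 <= i < j.+1) mutilde f (s - i)) * Tbar f (s - j) (a * x + b).

(** Integrating level [j.+1] uses up one factor [a] through the substitution and one factor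
    [mutilde] through the recursion. The condition [0 <= a * p + b] keeps arguments off the negative
    axis, where [Tbar] is not given by the tail formula. *)
Lemma scaled_Tbar_tail f s j a b p : nonneg_density f ->
  finite_mutilde_upto f s -> (j < s)%N -> 0 < a -> 0 <= a * p + b ->
  tail_integrable p (scaled_Tbar f s j.+1 a b) /\
  (forall x, p <= x -> scaled_Tbar f s j a b x = tail (scaled_Tbar f s j.+1 a b) x).
Proof.
move=> df fin js a0 pb.
have [gi m0 _] : regular_Tbar f (s - j.+1).
  by apply: (regular_TbarP df fin); rewrite ltn_subrL (leq_ltn_trans _ js).
have [mg g0 _] := gi.
set g := Tbar f (s - j.+1) in gi mg g0.
pose P := \prod_(1 <= i < j.+1) mutilde f (s - i).
have P0 : 0 < P.
  rewrite /P big_nat_cond; apply: prodr_gt0 => i /andP[/andP[i1 ij] _].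
  suff [] : regular_Tbar f (s - i) by [].
  apply: (regular_TbarP df fin).
  by rewrite ltn_subrL i1 (leq_ltn_trans _ js).
pose c := a ^+ j / (P * mutilde f (s - j.+1)).
have c0 : 0 < c by rewrite divr_gt0 ?exprn_gt0 ?mulr_gt0.
have WE : scaled_Tbar f s j.+1 a b = (fun x => c * (a * g (a * x + b))).
  apply/funext => x; rewrite /scaled_Tbar big_nat_recr//= -/P -/g /c exprS.
  by ring.
have mga : measurable_fun setT (fun x => a * g (a * x + b)).
  apply: measurable_funM; first exact: measurable_cst.
  by apply: (measurableT_comp mg); exact: measurable_affine.
have ga0 x : 0 <= a * g (a * x + b) by rewrite mulr_ge0// ltW.
have tE x : p <= x ->
    etail (scaled_Tbar f s j.+1 a b) x = (c * tail g (a * x + b))%:E.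
  move=> px; rewrite WE etailZ ?(ltW c0)// etail_affine// (etailE gi) ?EFinM//.
  by rewrite (le_trans pb)// lerD2r ler_pM2l.
split.
  split; last by rewrite tE// ltry.
    by rewrite WE; apply: measurable_funM => //; exact: measurable_cst.
  by move=> x; rewrite WE mulr_ge0// ltW.
move=> x px; rewrite /tail tE//= /scaled_Tbar -/P.
have -> : (s - j = (s - j.+1).+1)%N by rewrite subnSK.
rewrite TbarS -/g /c; last by rewrite (le_trans pb)// lerD2r ler_pM2l.
by field; rewrite !gt_eqF.
Qed.

Lemma H_kE fX fY s k a b : H_k fX fY s k a b =
  (fun x => scaled_Tbar fY s k 1 0 x - scaled_Tbar fX s k a b x).
Proof.
by apply/funext => x; rewrite /H_k /scaled_Tbar expr1n div1r mul1r addr0.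
Qed.

Lemma scaled_Tbar0 f s a b x : scaled_Tbar f s 0 a b x = Tbar f s (a * x + b).
Proof. by rewrite /scaled_Tbar big_geq// expr0 invr1 mulr1 mul1r subn0. Qed.

(** A point beyond [y3] where the two sides differ would act as [y4] in [crosses_mpm_tail_weak]. *)
Lemma mpm_Tbar_eventually_eq fX fY s k a b y1 y2 y3 :
  nonneg_density fX -> nonneg_density fY ->
  finite_mutilde_upto fX s -> finite_mutilde_upto fY s ->
  (1 <= k)%N -> (k <= s)%N -> 0 < a ->
  at_most_two_sign_changes_pmp (H_k fX fY s k a b) ->
  0 <= y1 -> 0 <= a * y1 + b -> y1 <= y2 -> y2 <= y3 ->
  Tbar fY s y1 <= Tbar fX s (a * y1 + b) ->
  Tbar fX s (a * y2 + b) < Tbar fY s y2 ->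
  Tbar fY s y3 <= Tbar fX s (a * y3 + b) ->
  forall y, y3 <= y -> Tbar fY s y = Tbar fX s (a * y + b).
Proof.
move=> dX dY finX finY k1 ks a0 H y10 ay1 y12 y23 h1 h2 h3 y y3y.
apply/eqP/negPn/negP => h4.
have y10' : 0 <= 1 * y1 + 0 by rewrite mul1r addr0.
have tY j (js : (j < s)%N) := scaled_Tbar_tail dY finY js ltr01 y10'.
have tX j (js : (j < s)%N) := scaled_Tbar_tail dX finX js a0 ay1.
suff : crosses_mpm y1 (scaled_Tbar fY s k 1 0) (scaled_Tbar fX s k a b).
  by move/(crosses_mpm_sign_changes y10); apply; rewrite -H_kE.
(* The base case passes from the weak pattern at level 0 to the strict one at level 1; each later
   level inherits the strict pattern. *)
case: k k1 ks {H} => // k _; elim: k => [|k IH] ks.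
  have [ui uE] := tY _ ks; have [vi vE] := tX _ ks.
  have y13 := le_trans y12 y23.
  apply: (crosses_mpm_tail_weak ui vi (lexx y1) y12 y23 y3y);
    rewrite -?uE -?vE ?scaled_Tbar0 ?mul1r ?addr0//; exact: le_trans y3y.
have [ui uE] := tY _ ks; have [vi vE] := tX _ ks.
apply: (crosses_mpm_tail ui vi).
exact: eq_crosses_mpm uE vE (IH (ltnW ks)).
Qed.

End IteratedTail.

(** * Generalized inverses *)

Section GeneralizedInverse.
Set Implicit Arguments. Unset Strict Implicit. Unset Printing Implicit Defensive.
Context {R : realType}.
Implicit Types (T : R -> R) (w y : R).

Lemma geninv_ge0 T w : 0 <= geninv T w.
Proof.
rewrite /geninv; set E := (X in inf X); have [->|ne] := eqVneq E set0.
  by rewrite inf0.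
by apply: lb_le_inf; [exact/set0P|move=> y []].
Qed.

(** Some element of the set lies below [y], and monotonicity does the rest. Nonemptiness matters:
    the infimum of the empty set is 0 by default. *)
Lemma geninv_lt T w y : (forall x z, x <= z -> T z <= T x) ->
  (exists x, 0 <= x /\ T x <= w) -> geninv T w < y -> T y <= w.
Proof.
move=> Tdec ne; rewrite /geninv => /inf_lt [] // x [x0 Tx] xy.
by apply: le_trans Tx; apply: Tdec; exact: ltW.
Qed.

Lemma lt_geninv T w y : 0 <= y -> y < geninv T w -> w < T y.
Proof.
move=> y0 yw; rewrite ltNge; apply/negP => Ty.
suff : geninv T w <= y by rewrite leNgt yw.
by apply: ge_inf => //; exists 0 => z [].
Qed.

End GeneralizedInverse.

(** * From sign changes to convexity of [c_s] *)

Theorem theorem7 (R : realType) (s : nat) (fX fY : R -> R) :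
  (1 <= s)%N ->
  nonneg_density fX -> nonneg_density fY ->
  finite_mutilde_upto fX s -> finite_mutilde_upto fY s ->
  (exists k : nat, [/\ (1 <= k)%N, (k <= s)%N &
     forall a b : R, 0 < a -> at_most_two_sign_changes_pmp (H_k fX fY s k a b)]) ->
  s_IFR_le fX fY s.
Proof.
move=> s1 dX dY finX finY [k [k1 ks Hk]].
have ps : (s.-1 < s)%N by rewrite prednK.
have regX := regular_TbarP dX finX ps; have regY := regular_TbarP dY finY ps.
pose TX := Tbar fX s; pose TY := Tbar fY s; pose c := c_s fX fY s.
have sE : s = s.-1.+1 by rewrite prednK.
have decX x y : x <= y -> TX y <= TX x by rewrite /TX sE; exact: le_TbarS.
have decY x y : x <= y -> TY y <= TY x by rewrite /TY sE; exact: le_TbarS.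
have smallX e : 0 < e -> exists x, 0 <= x /\ TX x < e.
  by rewrite /TX sE; exact: TbarS_small.
have smallY e : 0 < e -> exists x, 0 <= x /\ TY x < e.
  by rewrite /TY sE; exact: TbarS_small.
have c_ge0 x : 0 <= c x by exact: geninv_ge0.
have c_lt x y : 0 < TX x -> c x < y -> TY y <= TX x.
  move=> Tx; apply: geninv_lt => //; have [z [z0 zT]] := smallY _ Tx.
  by exists z; split => //; exact: ltW.
have lt_c x y : 0 <= y -> y < c x -> TX x < TY y by exact: lt_geninv.
have c_le x y : 0 < TX y -> x <= y -> c x <= c y.
  move=> Ty xy; rewrite leNgt; apply/negP => cyx.
  (* The midpoint [m] of [c y] and [c x] would give [TX x < TY m <= TX y]. *)
  have m1 : c y < (c x + c y) / 2 by lra.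
  have m2 : (c x + c y) / 2 < c x by lra.
  have m0 : 0 <= (c x + c y) / 2 by have := c_ge0 x; have := c_ge0 y; lra.
  have := c_lt _ _ Ty m1; have := lt_c _ _ m0 m2; have := decX _ _ xy; lra.
(* The points may be ordered, since exchanging them replaces [t] by [1 - t]. *)
suff cvx x y t : x < y -> 0 <= x -> 0 < TX y -> 0 <= t <= 1 ->
    c (t * x + (1 - t) * y) <= t * c x + (1 - t) * c y.
  move=> x y t [x0 Tx] [y0 Ty] t01; rewrite -/(c _) -/(c x) -/(c y).
  have [xy|yx|<-] := ltgtP x y; first exact: cvx.
    have := cvx y x (1 - t) yx y0 Tx.
    rewrite (_ : (1 - t) * y + (1 - (1 - t)) * x = t * x + (1 - t) * y); last by ring.
    rewrite (_ : (1 - t) * c y + (1 - (1 - t)) * c x = t * c x + (1 - t) * c y); last by ring.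
    apply; lra.
  rewrite (_ : t * x + (1 - t) * x = x); last by ring.
  by rewrite (_ : t * c x + (1 - t) * c x = c x) //; ring.
move=> xy x0 Ty /andP[t0 t1]; rewrite leNgt; apply/negP => nc.
set z := t * x + (1 - t) * y in nc.
(* The height of [c z] above the chord. *)
set g := c z - (t * c x + (1 - t) * c y).
have g0 : 0 < g by rewrite /g; lra.
have xz : x <= z by rewrite /z; nra.
have zy : z <= y by rewrite /z; nra.
have Tz : 0 < TX z by exact: lt_le_trans (decX _ _ zy).
have Tx : 0 < TX x by exact: lt_le_trans (decX _ _ (ltW xy)).
have cxy : c x <= c y by exact: c_le (ltW xy).
have yx0 : 0 < y - x by lra.
(* Slope of the chord with its right end raised by [g / 4]; it is positive even when [c x = c y]. *)
pose q := (c y - c x + g / 4) / (y - x).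
have q0 : 0 < q by rewrite /q divr_gt0//; lra.
have qy : q * (y - x) = c y - c x + g / 4.
  by rewrite /q divfK// gt_eqF.
have qz : q * (z - x) = (1 - t) * (c y - c x + g / 4).
  by rewrite -qy /z; ring.
have line e : 0 < e -> e <= g / 4 -> forall w, y <= w ->
    TY (c x + e + q * (w - x)) = TX w.
  move=> e0 eg w yw.
  (* The line solved for [v], which gives the parameters [a = q^-1] and
     [b = x - q^-1 * (c x + e)]. *)
  have aff v : q^-1 * (c x + e + q * (v - x)) + (x - q^-1 * (c x + e)) = v.
    by field; rewrite gt_eqF.
  rewrite -[in RHS](aff w).
  (* The line exceeds [c] by [e] at [x] and by [e + g / 4] at [y]; at [z] it stays at least [g / 2]
     below. *)
  apply: (@mpm_Tbar_eventually_eq R fX fY s k q^-1 (x - q^-1 * (c x + e))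
    (c x + e + q * (x - x)) (c x + e + q * (z - x)) (c x + e + q * (y - x)));
    rewrite ?aff ?invr_gt0// -/TX -/TY.
  - by apply: Hk; rewrite invr_gt0.
  - by have := c_ge0 x; rewrite subrr mulr0; lra.
  - by rewrite lerD2l ler_pM2l// lerD2r.
  - by rewrite lerD2l ler_pM2l// lerD2r.
  - by apply: c_lt => //; rewrite subrr mulr0; lra.
  - apply: lt_c; rewrite qz; first by have := c_ge0 x; nra.
    by move: nc; rewrite /g in g0 eg *; nra.
  - by apply: c_lt => //; rewrite qy; lra.
  - by rewrite lerD2l ler_pM2l// lerD2r.
(* Horizontal distance between the parallel lines for [e = g / 4] and [e = g / 8]. *)
pose d := g / 8 / q.
have d0 : 0 < d by apply: divr_gt0 => //; lra.
have period w : y <= w -> TX (w + d) = TX w.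
  move=> yw; rewrite -[RHS](line (g / 4))//; last lra.
  rewrite -(line (g / 8)); [|lra..].
  by congr TY; rewrite /d; field; rewrite gt_eqF.
have iterT n : TX (y + d *+ n) = TX y.
  elim: n => [|n IH]; first by rewrite mulr0n addr0.
  by rewrite mulrS addrCA addrC period// lerDl mulrn_wge0// ltW.
(* [TX] falls below [TX y] at [v], yet takes the value [TX y] again at a point [y + d *+ n] beyond
   [v]. *)
have [v [v0 vy]] := smallX _ Ty.
have : v <= y + d *+ Num.bound (v / d).
  have : v / d < (Num.bound (v / d))%:R by apply: archi_boundP; rewrite divr_ge0// ltW.
  rewrite ltr_pdivrMr// mulr_natl => vb.
  by rewrite ltW// (lt_le_trans vb)// lerDr; lra.
by move=> /decX; rewrite iterT leNgt vy.
Qed.
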